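(* Let $X$ be a nonabelian simple loop and let $k$ be a positive integer. Then the subdirect products of $X^k=X\times\cdots\times X$ are precisely the subloops $$S_X^\sim(\varphi_1,\dots,\varphi_k)=\{(x_1,\dots,x_k)\in X^k:\varphi_i(x_i)=\varphi_j(x_j)\text{ whenever }i\sim j\},$$ where $\sim$ is an equivalence relation on $\{1,\dots,k\}$ and $\varphi_1,\dots,\varphi_k$ are automorphisms of $X$.
   Context: A loop is an algebra $(X,\cdot,\backslash,/,e)$ satisfying $x(x\backslash y)=y=x\backslash(xy)$, $(x/y)y=x=(xy)/y$ and $ex=xe=x$. A normal subloop is the kernel of a loop homomorphism. A loop is abelian if it is an abelian group, and nonabelian otherwise (so a nonabelian loop may be commutative). A loop $X$ is simple if its only normal subloops are $\{e\}$ and $X$. A subloop $A$ of $\prod_{i\in I}X_i$ is a subdirect product of $\prod_{i\in I}X_i$ if for every $i\in I$ the $i$th coordinate projection maps $A$ onto $X_i$. *)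

(* Defs.v *)
From HB Require Import structures.
From mathcomp Require Import all_boot.
From mathcomp Require Import boolp classical_sets.

Set Implicit Arguments.
Unset Strict Implicit.
Unset Printing Implicit Defensive.

Local Open Scope group_scope.
Local Open Scope classical_set_scope.

(* [ldiv x y] is x\y and [rdiv x y] is x/y.  The structure extends
   [baseUMagmaType] rather than [umagmaType] because the latter would require
   a [choiceType] carrier. *)
HB.mixin Record BaseUMagma_isLoop X of BaseUMagma X := {
  ldiv : X -> X -> X;
  rdiv : X -> X -> X;
  mul_ldiv : forall x y : X, x * ldiv x y = y;
  ldiv_mul : forall x y : X, ldiv x (x * y) = y;
  rdiv_mul : forall x y : X, rdiv x y * y = x;
  mul_rdiv : forall x y : X, rdiv (x * y) y = x;
  loop_mul1x : forall x : X, 1 * x = x;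
  loop_mulx1 : forall x : X, x * 1 = x
}.

#[short(type="loopType")]
HB.structure Definition Loop := {X of BaseUMagma X & BaseUMagma_isLoop X}.

Definition loop_hom (X Y : loopType) (f : X -> Y) : Prop :=
  [/\ {morph f : x y / x * y}, {morph f : x y / ldiv x y},
      {morph f : x y / rdiv x y} & f 1 = 1].

Definition loop_aut (X : loopType) (f : X -> X) : Prop :=
  loop_hom f /\ bijective f.

Definition subloop (X : loopType) (A : set X) : Prop :=
  [/\ A 1, forall x y, A x -> A y -> A (x * y),
      forall x y, A x -> A y -> A (ldiv x y)
    & forall x y, A x -> A y -> A (rdiv x y)].

Definition normal_subloop (X : loopType) (N : set X) : Prop :=
  exists (Y : loopType) (f : X -> Y), loop_hom f /\ N = [set x | f x = 1].

Definition simple_loop (X : loopType) : Prop :=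
  forall N : set X, normal_subloop N -> N = [set 1] \/ N = [set: X].

(* The identity laws of an abelian group are part of the loop axioms. *)
Definition abelian_loop (X : loopType) : Prop :=
  [/\ associative (fun x y : X => x * y),
      exists inv : X -> X, left_inverse 1 inv (fun x y : X => x * y)
    & commutative (fun x y : X => x * y)].

Definition prod_loop (I : Type) (X : I -> loopType) : Type := forall i, X i.

Section ProdLoop.
Variables (I : Type) (X : I -> loopType).
Implicit Types x y : prod_loop X.

HB.instance Definition _ :=
  hasMul.Build (prod_loop X) (fun x y i => x i * y i).
HB.instance Definition _ := hasOne.Build (prod_loop X) (fun i => 1).

Definition prod_ldiv x y : prod_loop X := fun i => ldiv (x i) (y i).
Definition prod_rdiv x y : prod_loop X := fun i => rdiv (x i) (y i).

Fact prod_mul_ldiv x y : x * prod_ldiv x y = y.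
Proof. by apply: functional_extensionality_dep => i; exact: mul_ldiv. Qed.

Fact prod_ldiv_mul x y : prod_ldiv x (x * y) = y.
Proof. by apply: functional_extensionality_dep => i; exact: ldiv_mul. Qed.

Fact prod_rdiv_mul x y : prod_rdiv x y * y = x.
Proof. by apply: functional_extensionality_dep => i; exact: rdiv_mul. Qed.

Fact prod_mul_rdiv x y : prod_rdiv (x * y) y = x.
Proof. by apply: functional_extensionality_dep => i; exact: mul_rdiv. Qed.

Fact prod_mul1x x : 1 * x = x.
Proof. by apply: functional_extensionality_dep => i; exact: loop_mul1x. Qed.

Fact prod_mulx1 x : x * 1 = x.
Proof. by apply: functional_extensionality_dep => i; exact: loop_mulx1. Qed.

HB.instance Definition _ := BaseUMagma_isLoop.Build (prod_loop X)
  prod_mul_ldiv prod_ldiv_mul prod_rdiv_mul prod_mul_rdiv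
  prod_mul1x prod_mulx1.

End ProdLoop.

Definition subdirect_product (I : Type) (X : I -> loopType)
    (A : set (prod_loop X)) : Prop :=
  subloop A /\ forall i : I, [set a i | a in A] = [set: X i].

Definition power_loop (X : loopType) (k : nat) : loopType :=
  prod_loop (fun _ : 'I_k => X).

Definition twisted_diagonal (X : loopType) (k : nat) (r : rel 'I_k)
    (phi : 'I_k -> X -> X) : set (power_loop X k) :=
  [set x : prod_loop (fun _ : 'I_k => X) |
    forall i j, r i j -> phi i (x i) = phi j (x j)].

(* Main.v *)
Require Import Defs.
From HB Require Import structures.
From mathcomp Require Import all_boot.
From mathcomp Require Import boolp classical_sets.

(* For [i] in the index set and [T] a set of indices, the elements [a i] with
   [a] in [A] trivial on [T] form a normal subloop of [X], so this fibre is [1]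
   or [X].  Declare [i ~ j] when the fibre of [i] over [{j}] is trivial: then
   the projection of [A] to the coordinates [i, j] is the graph of an
   automorphism.  If the fibres of [i] over [T] and over [U] are both [X], then
   commutators and associators of elements trivial on [T] with elements trivial
   on [U] are trivial on [T] and on [U]; as [X] is nonabelian, the fibre over
   the union of [T] and [U] is nontrivial, hence [X].  So every value at [i] is
   attained by some member of [A] that is trivial outside the class of [i], and
   multiplying such members over the classes gives the whole twisted
   diagonal. *)

Set Implicit Arguments.
Unset Strict Implicit.
Unset Printing Implicit Defensive.

Local Open Scope group_scope.
Local Open Scope classical_set_scope.

(** * Loop identities and homomorphisms *)

Section LoopTheory.
Variable X : loopType.
Implicit Types x y : X.

Lemma rdivv x : rdiv x x = 1.
Proof. by rewrite -{1}(loop_mul1x x) mul_rdiv. Qed.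

Lemma rdivx1 x : rdiv x 1 = x.
Proof. by rewrite -{1}(loop_mulx1 x) mul_rdiv. Qed.

Lemma rdiv_eq1 x y : rdiv x y = 1 -> x = y.
Proof. by move=> h; rewrite -(rdiv_mul x y) h loop_mul1x. Qed.

Lemma abelian_loopP :
    (forall x y, rdiv (x * y) (y * x) = 1) ->
    (forall x y z, rdiv (x * (y * z)) (x * y * z) = 1) ->
  abelian_loop X.
Proof.
move=> hC hA; split.
- by move=> x y z; apply: rdiv_eq1.
- by exists (rdiv 1) => x; rewrite rdiv_mul.
- by move=> x y; apply: rdiv_eq1.
Qed.

End LoopTheory.

(** Quotients are the unique solutions of product equations, and [f 1] is idempotent, hence [1]. *)
Lemma loop_hom_morphM (X Y : loopType) (f : X -> Y) :
  {morph f : x y / x * y} -> loop_hom f.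
Proof.
move=> fM; split=> // [x y|x y|].
- by rewrite -(ldiv_mul (f x) (f (ldiv x y))) -fM mul_ldiv.
- by rewrite -(mul_rdiv (f (rdiv x y)) (f y)) -fM rdiv_mul.
- by rewrite -(rdivv (f 1)) -{2}(loop_mul1x 1) fM mul_rdiv.
Qed.

(** * Quotient of a loop by a congruence *)

Section Quotient.
Variables (X : loopType) (e : X -> X -> Prop).

Definition congruence :=
  [/\ forall x, e x x, forall x y, e x y -> e y x,
      forall x y z, e x y -> e y z -> e x z &
      forall x x' y y', e x x' -> e y y' ->
        [/\ e (x * y) (x' * y'), e (ldiv x y) (ldiv x' y')
          & e (rdiv x y) (rdiv x' y')]].

Hypothesis ce : congruence.

Definition crepr (x : X) : X := @xget {classic X} x [set y | e x y].

Let e_refl x : e x x. Proof. by case: ce. Qed.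
Let e_sym x y : e x y -> e y x. Proof. by case: ce => _ + _ _; apply. Qed.
Let e_trans y x z : e x y -> e y z -> e x z.
Proof. by case: ce => _ _ + _; apply. Qed.

Lemma e_crepr x : e x (crepr x).
Proof. exact: (@xgetI {classic X} x [set y | e x y] x (e_refl x)). Qed.

Lemma eq_crepr x y : e x y -> crepr x = crepr y.
Proof.
move=> exy; rewrite /crepr; have -> : [set z | e x z] = [set z | e y z].
  apply/seteqP; split=> z /=; [exact/e_trans/e_sym|exact: e_trans].
(* The choice depends only on the class, which is nonempty, so the differing defaults [x] and [y]
   are never reached. *)
rewrite /xget; case: pselect => // -[].
by exists y; apply/asboolP; apply: e_refl.
Qed.

Lemma crepr_idem x : crepr (crepr x) = crepr x.
Proof. exact/esym/eq_crepr/e_crepr. Qed.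

(* The congruence in the type only serves to make the instance below
   inferable. *)
Definition quot_loop (_ : congruence) : Type := {x : X | crepr x = x}.
Local Notation Q := (quot_loop ce).

Definition quot_pi x : Q := exist _ (crepr x) (crepr_idem x).

Lemma quot_piP x y : quot_pi x = quot_pi y <-> e x y.
Proof.
split=> [[exy]|exy]; last exact/eq_exist/eq_crepr.
by apply: e_trans (e_crepr x) _; rewrite exy; exact/e_sym/e_crepr.
Qed.

Lemma quot_piK (u : Q) : quot_pi (sval u) = u.
Proof. by case: u => x xP; apply/eq_exist. Qed.

Lemma e_quot_pi x : e (sval (quot_pi x)) x.
Proof. exact/e_sym/e_crepr. Qed.

Let eM x x' y y' : e x x' -> e y y' -> e (x * y) (x' * y').
Proof. by case: ce => _ _ _ h ex /(h _ _ _ _ ex) []. Qed.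
Let eL x x' y y' : e x x' -> e y y' -> e (ldiv x y) (ldiv x' y').
Proof. by case: ce => _ _ _ h ex /(h _ _ _ _ ex) []. Qed.
Let eR x x' y y' : e x x' -> e y y' -> e (rdiv x y) (rdiv x' y').
Proof. by case: ce => _ _ _ h ex /(h _ _ _ _ ex) []. Qed.

HB.instance Definition _ :=
  hasMul.Build Q (fun u v => quot_pi (sval u * sval v)).
HB.instance Definition _ := hasOne.Build Q (quot_pi 1).

Definition quot_ldiv (u v : Q) : Q := quot_pi (ldiv (sval u) (sval v)).
Definition quot_rdiv (u v : Q) : Q := quot_pi (rdiv (sval u) (sval v)).

Fact quot_mul_ldiv u v : u * quot_ldiv u v = v.
Proof.
rewrite -[RHS]quot_piK; apply/quot_piP;
rewrite -[X in e _ X](mul_ldiv (sval u) (sval v)).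
exact: eM (e_refl _) (e_quot_pi _).
Qed.

Fact quot_ldiv_mul u v : quot_ldiv u (u * v) = v.
Proof.
rewrite -[RHS]quot_piK; apply/quot_piP;
rewrite -[X in e _ X](ldiv_mul (sval u) (sval v)).
exact: eL (e_refl _) (e_quot_pi _).
Qed.

Fact quot_rdiv_mul u v : quot_rdiv u v * v = u.
Proof.
rewrite -[RHS]quot_piK; apply/quot_piP;
rewrite -[X in e _ X](rdiv_mul (sval u) (sval v)).
exact: eM (e_quot_pi _) (e_refl _).
Qed.

Fact quot_mul_rdiv u v : quot_rdiv (u * v) v = u.
Proof.
rewrite -[RHS]quot_piK; apply/quot_piP;
rewrite -[X in e _ X](mul_rdiv (sval u) (sval v)).
exact: eR (e_quot_pi _) (e_refl _).
Qed.

Fact quot_mul1x (u : Q) : 1 * u = u.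
Proof.
rewrite -[RHS]quot_piK; apply/quot_piP;
rewrite -[X in e _ X](loop_mul1x (sval u)).
exact: eM (e_quot_pi _) (e_refl _).
Qed.

Fact quot_mulx1 (u : Q) : u * 1 = u.
Proof.
rewrite -[RHS]quot_piK; apply/quot_piP;
rewrite -[X in e _ X](loop_mulx1 (sval u)).
exact: eM (e_refl _) (e_quot_pi _).
Qed.

HB.instance Definition _ := BaseUMagma_isLoop.Build Q
  quot_mul_ldiv quot_ldiv_mul quot_rdiv_mul quot_mul_rdiv
  quot_mul1x quot_mulx1.

Lemma quot_pi_hom : loop_hom (quot_pi : X -> Q).
Proof.
apply: loop_hom_morphM => x y; apply/quot_piP.
by apply: eM; apply: e_crepr.
Qed.

Lemma congruence_normal : normal_subloop [set x | e x 1].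
Proof.
exists Q, quot_pi; split; first exact: quot_pi_hom.
by apply/seteqP; split=> x /quot_piP.
Qed.

End Quotient.

(** * Fibres of a subdirect power *)

Section Subdirect.
Variables (X : loopType) (I : finType).
Local Notation P := (prod_loop (fun _ : I => X)).
Variable A : set P.
Hypotheses (hna : ~ abelian_loop X) (hsimple : simple_loop X).
Hypothesis sA : subdirect_product A.
Implicit Types (i j : I) (T U : set I) (x y : X) (a b : P).

Let A1 : A 1. Proof. by case: sA => -[]. Qed.
Let AM a b : A a -> A b -> A (a * b).
Proof. by case: sA => -[_ + _ _ _]; apply. Qed.
Let AL a b : A a -> A b -> A (ldiv a b).
Proof. by case: sA => -[_ _ + _ _]; apply. Qed.
Let AR a b : A a -> A b -> A (rdiv a b).
Proof. by case: sA => -[_ _ _ + _]; apply. Qed.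

Lemma subdirect_lift i x : exists a, A a /\ a i = x.
Proof.
have [_ /(_ i) h] := sA.
have : [set: X] x by [].
by rewrite -h => -[a Aa <-]; exists a.
Qed.

Definition fibre i T : set X :=
  [set x | exists a, [/\ A a, a i = x & forall j, T j -> a j = 1]].

(** Image at [i] of the congruence on [A] of agreeing on [T]; its class of [1] is [fibre i T], which
    is thereby a kernel. *)
Definition fibre_rel i T x y :=
  exists a b, [/\ A a /\ A b, a i = x, b i = y & forall j, T j -> a j = b j].

Lemma fibre_rel_congruence i T : congruence (fibre_rel i T).
Proof.
split.
- by move=> x; have [a [Aa ax]] := subdirect_lift i x; exists a, a.
- move=> x y [a [b [[Aa Ab] ax bx ab]]]; exists b, a; split=> // j /ab; exact: esym.
- move=> x y z [a [b [[Aa Ab] ax bx ab]]] [b' [c [[Ab' Ac] b'x cx bc]]].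
  (* [(a / b) * b'] is a Mal'cev term: it equals [a] at [i] and [b'] on [T]. *)
  exists (rdiv a b * b'), c; split=> //.
  + by split=> //; apply: AM => //; apply: AR.
  + by rewrite -[LHS]/(rdiv (a i) (b i) * b' i) ax bx b'x rdiv_mul.
  + move=> j Tj; rewrite -[LHS]/(rdiv (a j) (b j) * b' j) ab // rdivv loop_mul1x.
    exact: bc.
- move=> x x' y y' [a [a' [[Aa Aa'] <- <- aa]]] [b [b' [[Ab Ab'] <- <- bb]]].
  split.
  + exists (a * b), (a' * b'); split=> //; first by split; apply: AM.
    by move=> j Tj; congr (_ * _); [exact: aa|exact: bb].
  + exists (ldiv a b), (ldiv a' b'); split=> //; first by split; apply: AL.
    by move=> j Tj; congr (ldiv _ _); [exact: aa|exact: bb].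
  + exists (rdiv a b), (rdiv a' b'); split=> //; first by split; apply: AR.
    by move=> j Tj; congr (rdiv _ _); [exact: aa|exact: bb].
Qed.

Lemma fibre_normal i T : normal_subloop (fibre i T).
Proof.
have -> : fibre i T = [set x | fibre_rel i T x 1].
  apply/seteqP; split=> x.
    by move=> [a [Aa ax aT]]; exists a, 1; split.
  move=> [a [b [[Aa Ab] ax b1 ab]]]; exists (rdiv a b); split; first exact: AR.
    by rewrite -[LHS]/(rdiv (a i) (b i)) ax b1 rdivx1.
  by move=> j Tj; rewrite -[LHS]/(rdiv (a j) (b j)) ab // rdivv.
exact/congruence_normal/fibre_rel_congruence.
Qed.

Lemma fibre_dich i T : (forall x, fibre i T x -> x = 1) \/ forall x, fibre i T x.
Proof.
by case: (hsimple (fibre_normal i T)) => ->; [left=> x|right].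
Qed.

Lemma fibreU i T U :
    (forall x, fibre i T x) -> (forall x, fibre i U x) ->
  forall x, fibre i (T `|` U) x.
Proof.
move=> fT fU; have [f1|//] := fibre_dich i (T `|` U).
exfalso; apply: hna; apply: abelian_loopP => [x y|x y z]; apply: f1.
  have [a [Aa <- aT]] := fT x; have [b [Ab <- bU]] := fU y.
  exists (rdiv (a * b) (b * a)); split=> //; first by apply: AR; apply: AM.
  move=> j TUj; rewrite -[LHS]/(rdiv (a j * b j) (b j * a j)).
  by case: TUj => [/aT|/bU] ->; rewrite loop_mul1x loop_mulx1 rdivv.
have [a [Aa <- aT]] := fT x; have [b [Ab <- bU]] := fU y.
(* The associator collapses once its first or second entry is [1], so any lift of [z] will do. *)
have [c [Ac <-]] := subdirect_lift i z.
exists (rdiv (a * (b * c)) (a * b * c)); split=> //.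
  by apply: AR; do ?apply: AM.
move=> j TUj; rewrite -[LHS]/(rdiv (a j * (b j * c j)) (a j * b j * c j)).
by case: TUj => [/aT|/bU] ->; rewrite ?loop_mulx1 !loop_mul1x rdivv.
Qed.

(** * Linked coordinates *)

Definition linked : rel I := fun i j => `[< forall a, A a -> a j = 1 -> a i = 1 >].

Lemma linkedP i j :
  reflect (forall a, A a -> a j = 1 -> a i = 1) (linked i j).
Proof. exact: asboolP. Qed.

Lemma fibre_unlinked i j : ~~ linked i j -> forall x, fibre i [set j] x.
Proof.
move=> /linkedP nij; have [f1|//] := fibre_dich i [set j].
by case: nij => a Aa aj; apply: f1; exists a; split=> // _ ->.
Qed.

(** Otherwise, for any [b] in [A], some [a] in [A] has [a j = b j] and [a i = 1]; then [b / a] is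
    trivial at [j], hence at [i], where it equals [b i]. So [X] would be trivial, thus abelian. *)
Lemma linked_sym i j : linked i j -> linked j i.
Proof.
move=> /linkedP lij; apply: contrapT => /negP /fibre_unlinked fji.
apply: hna; suff triv x : x = 1.
  by apply: abelian_loopP => *; apply: triv.
have [b [Ab <-]] := subdirect_lift i x.
have [a [Aa aj ai]] := fji (b j).
have /lij : A (rdiv b a) by exact: AR.
rewrite -[rdiv b a j]/(rdiv (b j) (a j)) aj rdivv => /(_ erefl).
by rewrite -[rdiv b a i]/(rdiv (b i) (a i)) (ai i) ?rdivx1.
Qed.

Lemma linked_trans j i l : linked i j -> linked j l -> linked i l.
Proof.
by move=> /linkedP ij /linkedP jl; apply/linkedP => a Aa /(jl a Aa)/(ij a Aa).
Qed.

Lemma linked_equiv : equivalence_rel linked.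
Proof.
move=> i j l; split; first exact/linkedP.
move=> ij; apply/idP/idP; last exact: linked_trans.
exact/linked_trans/linked_sym.
Qed.

Lemma linked_eq i j a b : linked i j -> A a -> A b -> a j = b j -> a i = b i.
Proof.
move=> /linkedP lij Aa Ab abj; apply: rdiv_eq1.
apply: (lij (rdiv a b)); first exact: AR.
by rewrite -[LHS]/(rdiv (a j) (b j)) abj rdivv.
Qed.

(** The fibre over each unlinked singleton is full; as [I] is finite, [fibreU] joins the singletons
    one at a time. *)
Lemma fibre_class i x : fibre i [set j | ~~ linked i j] x.
Proof.
suff [a [Aa ax aT]] : fibre i [set j | j \in [seq j <- enum I | ~~ linked i j]] x.
  exists a; split=> // j nij; apply: aT.
  by rewrite /= mem_filter nij mem_enum.
elim: (enum I) x => [|j s IH] x.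
  by have [a [Aa ax]] := subdirect_lift i x; exists a.
rewrite /=; case: (boolP (linked i j)) => [_|nij] //=.
have [a [Aa ax aT]] := fibreU (fibre_unlinked nij) IH x.
exists a; split=> // l /=; rewrite inE => /orP[/eqP ->|ls].
  by apply: aT; left.
by apply: aT; right.
Qed.

(** * Automorphisms between linked coordinates *)

Definition transfer i j x : X :=
  @xget {classic P} (1 : P) [set a | A a /\ a i = x] j.

Lemma transferE i j a : linked i j -> A a -> transfer i j (a i) = a j.
Proof.
move=> /linked_sym lji Aa; rewrite /transfer.
case: xgetP => [b _ [Ab bi]|/(_ a) []//].
exact: linked_eq lji Ab Aa bi.
Qed.

(** Every value lifts to [A], where the map reads off another coordinate; [transfer j i] is the
    inverse. *)
Lemma transfer_aut i j : linked i j -> loop_aut (transfer i j).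
Proof.
move=> lij; split.
  apply: loop_hom_morphM => x y.
  have [a [Aa <-]] := subdirect_lift i x; have [b [Ab <-]] := subdirect_lift i y.
  by rewrite !transferE // -[RHS]/((a * b) j) -(transferE lij) //; apply: AM.
have lji := linked_sym lij.
exists (transfer j i) => x.
  by have [a [Aa <-]] := subdirect_lift i x; rewrite !transferE.
by have [a [Aa <-]] := subdirect_lift j x; rewrite !transferE.
Qed.

Definition class_repr i : I := odflt i [pick j | linked i j].

Lemma linked_class_repr i : linked i (class_repr i).
Proof.
by rewrite /class_repr; case: pickP => //= _; apply/linkedP.
Qed.

Lemma class_repr_eq i j : linked i j -> class_repr i = class_repr j.
Proof.
move=> lij; have eij l : linked i l = linked j l.
  by have [_ ->] := linked_equiv i j l.
rewrite /class_repr (eq_pick eij); case: pickP => //= /(_ j).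
by rewrite -eij lij.
Qed.

(** Both sides are the value of [a] at the common representative. *)
Lemma linked_transfer i j a : linked i j -> A a ->
  transfer i (class_repr i) (a i) = transfer j (class_repr j) (a j).
Proof.
move=> lij Aa; rewrite !transferE ?linked_class_repr //.
by rewrite (class_repr_eq lij).
Qed.

Lemma subdirect_full a :
    (forall i j, linked i j ->
      transfer i (class_repr i) (a i) = transfer j (class_repr j) (a j)) ->
  A a.
Proof.
move=> ha.
(* The point is assembled class by class: a coordinate whose class already meets [s] needs no new
   factor. *)
suff H (s : seq I) : exists b, A b /\
    forall j, b j = if has (linked j) s then a j else 1.
  have [b [Ab bE]] := H (enum I).
  suff -> : a = b by [].
  apply: functional_extensionality_dep => j; rewrite bE.
  case: hasP => // -[]; exists j; rewrite ?mem_enum //; exact/linkedP.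
elim: s => [|i s [b [Ab bE]]]; first by exists 1.
have [si|nsi] := boolP (has (linked i) s).
  exists b; split=> // j; rewrite bE /=.
  case: (boolP (linked j i)) => //= lji; case: hasP => // -[].
  by case/hasP: si => l ls il; exists l => //; apply: linked_trans lji il.
have [c [Ac ci c1]] := fibre_class i (a i).
exists (b * c); split; first exact: AM.
move=> j; rewrite -[LHS]/(b j * c j) bE /=.
have [lji /=|nji /=] := boolP (linked j i); last first.
  rewrite (c1 j) ?loop_mulx1 //=; apply: contra nji; exact: linked_sym.
rewrite ifF; last first.
  apply: contraNF nsi => /hasP[l ls jl]; apply/hasP; exists l => //.
  exact/(linked_trans _ jl)/linked_sym.
rewrite loop_mul1x.
(* Since [a] is not yet known to lie in [A], [c j] and [a j] are compared after the injective
   transfer to the representative, where both match the image of [a i]. *)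
have [_ /bij_inj] := transfer_aut (linked_class_repr j); apply.
by rewrite -(linked_transfer (linked_sym lji)) // ci; apply/ha/linked_sym.
Qed.

End Subdirect.

(** * Twisted diagonals and the characterization *)

Lemma twisted_diagonal_subdirect (X : loopType) (k : nat) (r : rel 'I_k)
    (phi : 'I_k -> X -> X) :
  (forall i, loop_aut (phi i)) -> subdirect_product (twisted_diagonal r phi).
Proof.
move=> phiA; split; first split.
- move=> i j _; have [[_ _ _ i1] _] := phiA i; have [[_ _ _ j1] _] := phiA j.
  exact: etrans i1 (esym j1).
- move=> x y dx dy i j rij.
  have [[iM _ _ _] _] := phiA i; have [[jM _ _ _] _] := phiA j.
  by rewrite iM jM (dx i j) // (dy i j).
- move=> x y dx dy i j rij.
  have [[_ iL _ _] _] := phiA i; have [[_ jL _ _] _] := phiA j.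
  by rewrite iL jL (dx i j) // (dy i j).
- move=> x y dx dy i j rij.
  have [[_ _ iR _] _] := phiA i; have [[_ _ jR _] _] := phiA j.
  by rewrite iR jR (dx i j) // (dy i j).
move=> i; apply/seteqP; split=> // x _.
have /choice[psi psiK] j : exists psi, cancel psi (phi j) /\ cancel (phi j) psi.
  by have [_ [psi phiK psiK]] := phiA j; exists psi.
(* Every [phi j] sends the coordinate at [j] to the same value [phi i x], so all constraints
   hold. *)
exists (fun j => psi j (phi i x)); last by case: (psiK i).
by move=> j l _; rewrite (psiK j).1 (psiK l).1.
Qed.

Theorem proposition4p2 (X : loopType) (hna : ~ abelian_loop X)
    (hsimple : simple_loop X) (k : nat) (hk : (0 < k)%N)
    (A : set (power_loop X k)) :
  subdirect_product A <->
  exists (r : rel 'I_k) (phi : 'I_k -> X -> X),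
    [/\ equivalence_rel r, forall i, loop_aut (phi i)
      & A = twisted_diagonal r phi].
Proof.
split=> [sA|[r [phi [_ phiA ->]]]]; last exact: twisted_diagonal_subdirect.
(* Carrying each coordinate to its class representative turns linkage into equality. *)
exists (linked A), (fun i => transfer A i (class_repr A i)); split.
- exact: linked_equiv.
- by move=> i; apply/transfer_aut/linked_class_repr.
apply/seteqP; split=> a; last exact: subdirect_full.
by move=> Aa i j lij; apply: linked_transfer.
Qed.
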